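(* Let $\sigma_\mu^2>0$, and for $n_0,n_1\ge 0$ let $D(n_0,n_1)=\sigma_\mu^2(n_1+n_0+2n_0n_1)+(1+n_0)(1+n_1)$ and $$V_L(n_0,n_1)=\frac{\sigma_\mu^4(n_1+n_0+2n_0n_1)}{D(n_0,n_1)},\qquad V_S(n_0,n_1)=V_L(n_0,n_1)+\frac{3\sigma_\mu^2n_0n_1+2\sigma_\mu^2n_1+n_1+n_0n_1}{D(n_0,n_1)}.$$ The functions $V_L$ and $V_S$ satisfy the following properties: (i) $V_L$ and $V_S$ are strictly increasing in both arguments. (ii) $V_L$ and $V_S$ are strictly concave. In particular, $\partial^2V_k(n_0,n_1)/\partial n_t^2$ and $\partial^2V_k(n_0,n_1)/\partial n_0\partial n_1$ are strictly negative for every $k\in\{S,L\}$ and $t\in\{0,1\}$. (iii) $V_L$ is symmetric, i.e. $V_L(x,y)=V_L(y,x)$. In contrast, $V_S(x,y)>V_S(y,x)$ if $y>x$, and for every $(n_0,n_1)$, $\dfrac{\partial V_S(n_0,n_1)}{\partial n_1}>\dfrac{\partial V_S(n_0,n_1)}{\partial n_0}$. (iv) $V_S(0,0)=V_L(0,0)=0$; $V_S(n_0,0)=V_L(n_0,0)$; and $V_S(n_0,n_1)>V_L(n_0,n_1)$ for every $n_0\ge 0$ and $n_1>0$. (v) For every $(n_0,n_1)$, $$\frac{\partial V_S(n_0,n_1)}{\partial n_1}>\frac{\partial V_L(n_0,n_1)}{\partial n_1},\qquad \frac{\partial V_L(n_0,n_1)}{\partial n_0}>\frac{\partial V_S(n_0,n_1)}{\partial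 n_0}.$$
   Context: $V_L$ and $V_S$ are the values of information for two types of data users: with $\mu\sim N(0,\sigma_\mu^2)$ and observations $y_{t,i}=\mu+x_t+\varepsilon_{t,i}$ ($t\in\{0,1\}$, $i=1,\dots,n_t$, $x_t,\varepsilon_{t,i}\sim N(0,1)$, all independent), $V_L(n_0,n_1)$ is the reduction in the variance of $\mu$ and $V_S(n_0,n_1)$ the reduction in the variance of $\mu+x_1$ from observing the sample. Sample sizes $n_0,n_1$ are allowed to take any non-negative real values.
   Formalization: The second inequality of (v) is stated only for n_1>0: at n_1=0 it is false as printed, since V_S(n_0,0)=V_L(n_0,0) for all n_0 makes the two n_0-derivatives equal there. *)

(* Defs.v *)
(* Stdlib reals with Coquelicot's derivatives. *)
From Stdlib Require Import Reals.
From Coquelicot Require Import Coquelicot.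
Open Scope R_scope.

(* [s] is the prior variance sigma_mu^2 itself, so sigma_mu^4 is [s ^ 2]. *)
Definition denom (s n0 n1 : R) : R :=
  s * (n1 + n0 + 2 * n0 * n1) + (1 + n0) * (1 + n1).

Definition VL (s n0 n1 : R) : R :=
  s ^ 2 * (n1 + n0 + 2 * n0 * n1) / denom s n0 n1.

Definition VS (s n0 n1 : R) : R :=
  VL s n0 n1
  + (3 * s * n0 * n1 + 2 * s * n1 + n1 + n0 * n1) / denom s n0 n1.

(* The following two notions are relative to the closed quadrant
   n0, n1 >= 0; nothing is required of [V] outside it. *)
Definition strictly_increasing (V : R -> R -> R) : Prop :=
  (forall n0 n0' n1, 0 <= n0 -> n0 < n0' -> 0 <= n1 -> V n0 n1 < V n0' n1) /\
  (forall n0 n1 n1', 0 <= n0 -> 0 <= n1 -> n1 < n1' -> V n0 n1 < V n0 n1').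

(* Joint concavity, as a function of the pair (n0, n1). *)
Definition strictly_concave (V : R -> R -> R) : Prop :=
  forall a0 a1 b0 b1 t : R,
    0 <= a0 -> 0 <= a1 -> 0 <= b0 -> 0 <= b1 ->
    (a0, a1) <> (b0, b1) -> 0 < t < 1 ->
    t * V a0 a1 + (1 - t) * V b0 b1
      < V (t * a0 + (1 - t) * b0) (t * a1 + (1 - t) * b1).

(* Two-sided partial derivatives. They are meaningful at the boundary points
   n0 = 0 or n1 = 0 as well: for s > 0 [denom] is positive on a
   neighbourhood of the closed quadrant, so the rational expressions [VL] and
   [VS] extend smoothly, and the two-sided derivative of the extension agrees
   with the one-sided derivative of the restriction to the quadrant. *)
Definition partial0 (V : R -> R -> R) (n0 n1 : R) : R :=
  Derive (fun x => V x n1) n0.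

Definition partial1 (V : R -> R -> R) (n0 n1 : R) : R :=
  Derive (fun y => V n0 y) n1.

Definition ex_partial0 (V : R -> R -> R) (n0 n1 : R) : Prop :=
  ex_derive (fun x => V x n1) n0.

Definition ex_partial1 (V : R -> R -> R) (n0 n1 : R) : Prop :=
  ex_derive (fun y => V n0 y) n1.

(* [Derive] is total, so inequalities between derivatives have their intended
   meaning only together with the existence of those derivatives. *)
Definition partials_exist (V : R -> R -> R) (n0 n1 : R) : Prop :=
  ex_partial0 V n0 n1 /\ ex_partial1 V n0 n1 /\
  ex_partial0 (partial0 V) n0 n1 /\ ex_partial1 (partial1 V) n0 n1 /\
  ex_partial0 (partial1 V) n0 n1.

(* Main.v *)
(** Up to an additive constant, both values of information are negated
    posterior variances.  The posterior precision of [mu] is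
    [1/s + n0/(1+n0) + n1/(1+n1)], and that of [mu + x_1] is [n1 + P n0] with
    [P] a strictly concave increasing Moebius map.  So both functions have the form
    [c - 1 / (p n0 + q n1)] with [p], [q] increasing and concave, from which
    monotonicity and joint concavity follow, [1/g] being convex and decreasing
    in [g].  For the derivative claims the first partial derivatives reduce to
    squares over [denom ^ 2], which makes every sign visible. *)
Require Import Defs.
From Stdlib Require Import Reals Lra.
From Coquelicot Require Import Coquelicot.
Open Scope R_scope.

(** * Convexity of the reciprocal on the positive reals *)

Lemma inv_convex (a b t : R) :
  0 < a -> 0 < b -> 0 < t < 1 ->
  / (t * a + (1 - t) * b) <= t * / a + (1 - t) * / b.
Proof.
  intros Ha Hb Ht.
  assert (Hm : 0 < t * a + (1 - t) * b) by nra.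
  apply Rminus_le_0.
  (* The convexity gap in closed form: its only possible zero is the factor [(a - b) ^ 2], which
     also decides strictness. *)
  replace (t * / a + (1 - t) * / b - / (t * a + (1 - t) * b))
    with (t * (1 - t) * (a - b) ^ 2 / (a * b * (t * a + (1 - t) * b)))
    by (field; lra).
  apply Rdiv_le_0_compat.
  - apply Rmult_le_pos; [nra | apply pow2_ge_0].
  - repeat apply Rmult_lt_0_compat; lra.
Qed.

Lemma inv_strictly_convex (a b t : R) :
  0 < a -> 0 < b -> a <> b -> 0 < t < 1 ->
  / (t * a + (1 - t) * b) < t * / a + (1 - t) * / b.
Proof.
  intros Ha Hb Hab Ht.
  assert (Hm : 0 < t * a + (1 - t) * b) by nra.
  apply Rminus_lt_0.
  replace (t * / a + (1 - t) * / b - / (t * a + (1 - t) * b))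
    with (t * (1 - t) * (a - b) ^ 2 / (a * b * (t * a + (1 - t) * b)))
    by (field; lra).
  apply Rdiv_lt_0_compat.
  - apply Rmult_lt_0_compat; [nra | apply pow2_gt_0; lra].
  - repeat apply Rmult_lt_0_compat; lra.
Qed.

(** * Functions of the form [c - / (p x + q y)] *)

Definition increasing_on_nonneg (f : R -> R) : Prop :=
  forall x y, 0 <= x -> x < y -> f x < f y.

Definition concave_on_nonneg (f : R -> R) : Prop :=
  forall x y t, 0 <= x -> 0 <= y -> 0 < t < 1 ->
    t * f x + (1 - t) * f y <= f (t * x + (1 - t) * y).

Definition strictly_concave_on_nonneg (f : R -> R) : Prop :=
  forall x y t, 0 <= x -> 0 <= y -> x <> y -> 0 < t < 1 ->
    t * f x + (1 - t) * f y < f (t * x + (1 - t) * y).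

Lemma strictly_concave_on_nonneg_concave (f : R -> R) :
  strictly_concave_on_nonneg f -> concave_on_nonneg f.
Proof.
  intros Hf x y t Hx Hy Ht.
  destruct (Req_dec x y) as [<- | Hxy].
  - replace (t * x + (1 - t) * x) with x by ring. lra.
  - left. now apply Hf.
Qed.

Section SubInvSum.

Variables (V : R -> R -> R) (c : R) (p q : R -> R).
Hypothesis V_eq : forall x y, 0 <= x -> 0 <= y -> V x y = c - / (p x + q y).
Hypothesis pq_pos : forall x y, 0 <= x -> 0 <= y -> 0 < p x + q y.
Hypothesis q_incr : increasing_on_nonneg q.

Lemma sub_inv_sum_strictly_increasing :
  increasing_on_nonneg p -> strictly_increasing V.
Proof.
  intros p_incr. split.
  - intros x x' y Hx Hxx Hy.
    rewrite !V_eq by lra.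
    apply Rplus_lt_compat_l, Ropp_lt_contravar, Rinv_lt_contravar.
    + apply Rmult_lt_0_compat; apply pq_pos; lra.
    + specialize (p_incr _ _ Hx Hxx). lra.
  - intros x y y' Hx Hy Hyy.
    rewrite !V_eq by lra.
    apply Rplus_lt_compat_l, Ropp_lt_contravar, Rinv_lt_contravar.
    + apply Rmult_lt_0_compat; apply pq_pos; lra.
    + specialize (q_incr _ _ Hy Hyy). lra.
Qed.

(** Asking only plain concavity of [q] admits the identity, which is the [q] of [VS]. Along segments
    with constant first coordinate, strict monotonicity of [q] takes over. *)
Lemma sub_inv_sum_strictly_concave :
  strictly_concave_on_nonneg p -> concave_on_nonneg q -> strictly_concave V.
Proof.
  intros p_conc q_conc a0 a1 b0 b1 t Ha0 Ha1 Hb0 Hb1 Hab Ht.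
  assert (Hm0 : 0 <= t * a0 + (1 - t) * b0) by nra.
  assert (Hm1 : 0 <= t * a1 + (1 - t) * b1) by nra.
  rewrite !V_eq by assumption.
  pose proof (pq_pos _ _ Ha0 Ha1) as Hga.
  pose proof (pq_pos _ _ Hb0 Hb1) as Hgb.
  pose proof (pq_pos _ _ Hm0 Hm1) as Hgm.
  pose proof (q_conc _ _ _ Ha1 Hb1 Ht) as Hq.
  assert (Hmean : 0 < t * (p a0 + q a1) + (1 - t) * (p b0 + q b1)) by nra.
  enough (/ (p (t * a0 + (1 - t) * b0) + q (t * a1 + (1 - t) * b1))
          < t * / (p a0 + q a1) + (1 - t) * / (p b0 + q b1)) by lra.
  destruct (Req_dec a0 b0) as [<- | H0].
  - (* [p] contributes nothing here: strictness comes from [1/g]. *)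
    assert (H1 : q a1 <> q b1).
    { destruct (Rtotal_order a1 b1) as [H | [<- | H]].
      - specialize (q_incr _ _ Ha1 H). lra.
      - now contradiction Hab.
      - specialize (q_incr _ _ Hb1 H). lra. }
    apply Rle_lt_trans with (/ (t * (p a0 + q a1) + (1 - t) * (p a0 + q b1))).
    + apply Rinv_le_contravar; [assumption |].
      replace (t * a0 + (1 - t) * a0) with a0 by ring. lra.
    + apply inv_strictly_convex; lra.
  - apply Rlt_le_trans with (/ (t * (p a0 + q a1) + (1 - t) * (p b0 + q b1))).
    + apply Rinv_lt_contravar; [now apply Rmult_lt_0_compat |].
      specialize (p_conc _ _ _ Ha0 Hb0 H0 Ht). lra.
    + now apply inv_convex.
Qed.

End SubInvSum.

(** * Increasing, strictly concave Moebius maps *)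

Section Moebius.

Variables a b k m : R.
Hypotheses (Hk : 0 < k) (Hb : 0 < b) (Hm : 0 < m).

Lemma moebius_increasing :
  increasing_on_nonneg (fun x => a - k * / (b + m * x)).
Proof.
  intros x y Hx Hxy.
  apply Rplus_lt_compat_l, Ropp_lt_contravar, Rmult_lt_compat_l; [assumption |].
  apply Rinv_lt_contravar; [apply Rmult_lt_0_compat |]; nra.
Qed.

Lemma moebius_strictly_concave :
  strictly_concave_on_nonneg (fun x => a - k * / (b + m * x)).
Proof.
  intros x y t Hx Hy Hxy Ht.
  assert (H : / (t * (b + m * x) + (1 - t) * (b + m * y))
              < t * / (b + m * x) + (1 - t) * / (b + m * y)).
  { apply inv_strictly_convex; [nra | nra | | assumption].
    intros E. apply Hxy, Rmult_eq_reg_l with m; lra. }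
  replace (b + m * (t * x + (1 - t) * y))
    with (t * (b + m * x) + (1 - t) * (b + m * y)) by ring.
  apply (Rmult_lt_compat_l k) in H; [lra | assumption].
Qed.

End Moebius.

(** * Values of information as prior minus posterior variance *)

Lemma denom_pos (s x y : R) :
  0 < s -> 0 <= x -> 0 <= y -> 0 < denom s x y.
Proof.
  intros Hs Hx Hy. unfold denom.
  assert (0 <= x * y) by nra.
  assert (0 <= s * (y + x + 2 * x * y)) by (apply Rmult_le_pos; nra).
  nra.
Qed.

Section Precision.

Variable s : R.
Hypothesis Hs : 0 < s.

(* The prior precision [1/s] is split evenly between the two arguments, so that
   [precL n0 + precL n1] is the posterior precision of [mu]. *)
Definition precL (x : R) : R := (/ (2 * s) + 1) - 1 * / (1 + 1 * x).

(** The posterior precision of [mu + x_1] given only [x] observations from period 0, in partial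
    fractions so as to match the Moebius lemmas. *)
Definition precS (x : R) : R :=
  (1 + s) / (1 + 2 * s) - s ^ 2 / (1 + 2 * s) * / ((1 + s) + (1 + 2 * s) * x).

Lemma precL_pos (x : R) : 0 <= x -> 0 < precL x.
Proof.
  intros Hx.
  replace (precL x) with (/ (2 * s) + x / (1 + x)) by (unfold precL; field; lra).
  apply Rplus_lt_le_0_compat.
  - apply Rinv_0_lt_compat. lra.
  - apply Rdiv_le_0_compat; lra.
Qed.

Lemma precS_pos (x : R) : 0 <= x -> 0 < precS x.
Proof.
  intros Hx.
  replace (precS x) with ((1 + (1 + s) * x) / ((1 + s) + (1 + 2 * s) * x))
    by (unfold precS; field; nra).
  apply Rdiv_lt_0_compat; nra.
Qed.

Lemma VL_precision (x y : R) :
  0 <= x -> 0 <= y -> VL s x y = s - / (precL x + precL y).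
Proof.
  intros Hx Hy.
  pose proof (denom_pos s x y Hs Hx Hy) as HD.
  replace (precL x + precL y) with (denom s x y / (s * (1 + x) * (1 + y)))
    by (unfold precL, denom; field; lra).
  rewrite Rinv_div. unfold VL, denom in *. field. lra.
Qed.

(** The prior variance is [s + 1]. Period-1 observations are signals of [mu + x_1] with unit noise,
    so [y] of them add exactly [y] to the precision. *)
Lemma VS_precision (x y : R) :
  0 <= x -> 0 <= y -> VS s x y = (s + 1) - / (precS x + y).
Proof.
  intros Hx Hy.
  pose proof (denom_pos s x y Hs Hx Hy) as HD.
  replace (precS x + y) with (denom s x y / ((1 + s) + (1 + 2 * s) * x))
    by (unfold precS, denom; field; nra).
  rewrite Rinv_div. unfold VS, VL, denom in *. field. lra.
Qed.

Lemma VL_strictly_increasing : strictly_increasing (VL s).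
Proof.
  apply sub_inv_sum_strictly_increasing with s precL precL.
  - exact VL_precision.
  - intros x y Hx Hy. pose proof (precL_pos x Hx). pose proof (precL_pos y Hy). lra.
  (* The explicit factors 1 in [precL] let it unify with [a - k * / (b + m * x)]. *)
  - apply moebius_increasing; lra.
  - apply moebius_increasing; lra.
Qed.

Lemma VL_strictly_concave : strictly_concave (VL s).
Proof.
  apply sub_inv_sum_strictly_concave with s precL precL.
  - exact VL_precision.
  - intros x y Hx Hy. pose proof (precL_pos x Hx). pose proof (precL_pos y Hy). lra.
  - apply moebius_increasing; lra.
  - apply moebius_strictly_concave; lra.
  - apply strictly_concave_on_nonneg_concave, moebius_strictly_concave; lra.
Qed.

Lemma VS_strictly_increasing : strictly_increasing (VS s).
Proof.
  apply sub_inv_sum_strictly_increasing with (s + 1) precS (fun y => y).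
  - exact VS_precision.
  - intros x y Hx Hy. pose proof (precS_pos x Hx). lra.
  - now intros x y _.
  - apply moebius_increasing; [apply Rdiv_lt_0_compat |..]; nra.
Qed.

Lemma VS_strictly_concave : strictly_concave (VS s).
Proof.
  apply sub_inv_sum_strictly_concave with (s + 1) precS (fun y => y).
  - exact VS_precision.
  - intros x y Hx Hy. pose proof (precS_pos x Hx). lra.
  - now intros x y _.
  - apply moebius_strictly_concave; [apply Rdiv_lt_0_compat |..]; nra.
  - intros x y t _ _ _. lra.
Qed.

End Precision.

(** * Closed forms of the first and second partial derivatives *)

Section Partials.

Variable s : R.

(** With one argument fixed, [VL] and [VS] are Moebius in the other, so each first partial is a
    determinant, constant in that variable, over the squared denominator. *)
Lemma VL_is_derive0 (x y : R) : denom s x y <> 0 ->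
  is_derive (fun x => VL s x y) x (s ^ 2 * (1 + y) ^ 2 / denom s x y ^ 2).
Proof.
  unfold VL, denom. intros HD. auto_derive; [assumption | field; assumption].
Qed.

Lemma VL_is_derive1 (x y : R) : denom s x y <> 0 ->
  is_derive (fun y => VL s x y) y (s ^ 2 * (1 + x) ^ 2 / denom s x y ^ 2).
Proof.
  unfold VL, denom. intros HD. auto_derive; [assumption | field; assumption].
Qed.

Lemma VS_is_derive0 (x y : R) : denom s x y <> 0 ->
  is_derive (fun x => VS s x y) x (s ^ 2 / denom s x y ^ 2).
Proof.
  unfold VS, VL, denom. intros HD. auto_derive; [tauto | field; assumption].
Qed.

Lemma VS_is_derive1 (x y : R) : denom s x y <> 0 ->
  is_derive (fun y => VS s x y) y
    (((1 + s) + (1 + 2 * s) * x) ^ 2 / denom s x y ^ 2).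
Proof.
  unfold VS, VL, denom. intros HD. auto_derive; [tauto | field; assumption].
Qed.

(** Lets a closed form of a first partial be differentiated again. The closed form holds where
    [denom] is nonzero; this set is open, unlike the quadrant, so boundary points get a two-sided
    neighbourhood. *)
Lemma is_derive0_congr (F G : R -> R -> R) (x y l : R) :
  (forall x y, denom s x y <> 0 -> F x y = G x y) -> denom s x y <> 0 ->
  is_derive (fun x => G x y) x l -> is_derive (fun x => F x y) x l.
Proof.
  intros FG HD. apply is_derive_ext_loc.
  apply (filter_imp (fun x' => denom s x' y <> 0)).
  - intros x' Hx'. symmetry. now apply FG.
  - apply (open_comp (fun x' => denom s x' y) (fun u => u <> 0)).
    + intros x' _. apply (ex_derive_continuous (fun x' => denom s x' y)).
      unfold denom. now auto_derive.
    + apply open_neq.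
    + assumption.
Qed.

Lemma is_derive1_congr (F G : R -> R -> R) (x y l : R) :
  (forall x y, denom s x y <> 0 -> F x y = G x y) -> denom s x y <> 0 ->
  is_derive (fun y => G x y) y l -> is_derive (fun y => F x y) y l.
Proof.
  intros FG HD. apply is_derive_ext_loc.
  apply (filter_imp (fun y' => denom s x y' <> 0)).
  - intros y' Hy'. symmetry. now apply FG.
  - apply (open_comp (fun y' => denom s x y') (fun u => u <> 0)).
    + intros y' _. apply (ex_derive_continuous (fun y' => denom s x y')).
      unfold denom. now auto_derive.
    + apply open_neq.
    + assumption.
Qed.

Lemma VL_partial0 (x y : R) : denom s x y <> 0 ->
  partial0 (VL s) x y = s ^ 2 * (1 + y) ^ 2 / denom s x y ^ 2.
Proof. intros HD. now apply is_derive_unique, VL_is_derive0. Qed.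

Lemma VL_partial1 (x y : R) : denom s x y <> 0 ->
  partial1 (VL s) x y = s ^ 2 * (1 + x) ^ 2 / denom s x y ^ 2.
Proof. intros HD. now apply is_derive_unique, VL_is_derive1. Qed.

Lemma VS_partial0 (x y : R) : denom s x y <> 0 ->
  partial0 (VS s) x y = s ^ 2 / denom s x y ^ 2.
Proof. intros HD. now apply is_derive_unique, VS_is_derive0. Qed.

Lemma VS_partial1 (x y : R) : denom s x y <> 0 ->
  partial1 (VS s) x y = ((1 + s) + (1 + 2 * s) * x) ^ 2 / denom s x y ^ 2.
Proof. intros HD. now apply is_derive_unique, VS_is_derive1. Qed.

(** Only the denominator varies with [x]; its derivative is [(1 + s) + (1 + 2 * s) * y]. *)
Lemma VL_is_derive0_partial0 (x y : R) : denom s x y <> 0 ->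
  is_derive (fun x => partial0 (VL s) x y) x
    (- (2 * (s ^ 2 * (1 + y) ^ 2 * ((1 + s) + (1 + 2 * s) * y)) / denom s x y ^ 3)).
Proof.
  intros HD. apply (is_derive0_congr _ _ _ _ _ VL_partial0 HD).
  unfold denom in *. auto_derive; [| field; assumption].
  now apply (pow_nonzero _ 2).
Qed.

Lemma VL_is_derive1_partial1 (x y : R) : denom s x y <> 0 ->
  is_derive (fun y => partial1 (VL s) x y) y
    (- (2 * (s ^ 2 * (1 + x) ^ 2 * ((1 + s) + (1 + 2 * s) * x)) / denom s x y ^ 3)).
Proof.
  intros HD. apply (is_derive1_congr _ _ _ _ _ VL_partial1 HD).
  unfold denom in *. auto_derive; [| field; assumption].
  now apply (pow_nonzero _ 2).
Qed.

Lemma VL_is_derive0_partial1 (x y : R) : denom s x y <> 0 ->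
  is_derive (fun x => partial1 (VL s) x y) x
    (- (2 * (s ^ 3 * (1 + x) * (1 + y)) / denom s x y ^ 3)).
Proof.
  intros HD. apply (is_derive0_congr _ _ _ _ _ VL_partial1 HD).
  unfold denom in *. auto_derive; [| field; assumption].
  now apply (pow_nonzero _ 2).
Qed.

Lemma VS_is_derive0_partial0 (x y : R) : denom s x y <> 0 ->
  is_derive (fun x => partial0 (VS s) x y) x
    (- (2 * (s ^ 2 * ((1 + s) + (1 + 2 * s) * y)) / denom s x y ^ 3)).
Proof.
  intros HD. apply (is_derive0_congr _ _ _ _ _ VS_partial0 HD).
  unfold denom in *. auto_derive; [| field; assumption].
  now apply (pow_nonzero _ 2).
Qed.

Lemma VS_is_derive1_partial1 (x y : R) : denom s x y <> 0 ->
  is_derive (fun y => partial1 (VS s) x y) y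
    (- (2 * (((1 + s) + (1 + 2 * s) * x) ^ 3) / denom s x y ^ 3)).
Proof.
  intros HD. apply (is_derive1_congr _ _ _ _ _ VS_partial1 HD).
  unfold denom in *. auto_derive; [| field; assumption].
  now apply (pow_nonzero _ 2).
Qed.

(** With [B = (1 + s) + (1 + 2 * s) * x], the quotient rule for [B / denom] leaves the numerator
    [(1 + 2 * s) - (1 + s) ^ 2 = - s ^ 2]. *)
Lemma VS_is_derive0_partial1 (x y : R) : denom s x y <> 0 ->
  is_derive (fun x => partial1 (VS s) x y) x
    (- (2 * (s ^ 2 * ((1 + s) + (1 + 2 * s) * x)) / denom s x y ^ 3)).
Proof.
  intros HD. apply (is_derive0_congr _ _ _ _ _ VS_partial1 HD).
  unfold denom in *. auto_derive; [| field; assumption].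
  now apply (pow_nonzero _ 2).
Qed.

End Partials.

(** The same [is_derive] facts yield both existence and sign; writing the values as negations leaves
    only positivity goals. *)
Lemma second_partials_neg (V : R -> R -> R) (x y d0 d1 l00 l11 l01 : R) :
  is_derive (fun x => V x y) x d0 -> is_derive (fun y => V x y) y d1 ->
  is_derive (fun x => partial0 V x y) x (- l00) ->
  is_derive (fun y => partial1 V x y) y (- l11) ->
  is_derive (fun x => partial1 V x y) x (- l01) ->
  0 < l00 -> 0 < l11 -> 0 < l01 ->
  partials_exist V x y /\
  partial0 (partial0 V) x y < 0 /\
  partial1 (partial1 V) x y < 0 /\
  partial0 (partial1 V) x y < 0.
Proof.
  intros H0 H1 H00 H11 H01 P00 P11 P01. split.
  - repeat split; eexists; eassumption.
  - apply is_derive_unique in H00, H11, H01.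
    change (partial0 (partial0 V) x y = - l00) in H00.
    change (partial1 (partial1 V) x y = - l11) in H11.
    change (partial0 (partial1 V) x y = - l01) in H01.
    lra.
Qed.

Theorem mainTheorem3 (s : R) (Hs : 0 < s) :
  (* (i) *)
  (strictly_increasing (VL s) /\ strictly_increasing (VS s)) /\
  (* (ii) *)
  ((strictly_concave (VL s) /\ strictly_concave (VS s)) /\
   (forall V : R -> R -> R, V = VL s \/ V = VS s ->
    forall n0 n1 : R, 0 <= n0 -> 0 <= n1 ->
      partials_exist V n0 n1 /\
      partial0 (partial0 V) n0 n1 < 0 /\
      partial1 (partial1 V) n0 n1 < 0 /\
      partial0 (partial1 V) n0 n1 < 0)) /\
  (* (iii) *)
  ((forall x y : R, 0 <= x -> 0 <= y -> VL s x y = VL s y x) /\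
   (forall x y : R, 0 <= x -> 0 <= y -> y > x -> VS s x y > VS s y x) /\
   (forall n0 n1 : R, 0 <= n0 -> 0 <= n1 ->
      partial1 (VS s) n0 n1 > partial0 (VS s) n0 n1)) /\
  (* (iv) *)
  ((VS s 0 0 = 0 /\ VL s 0 0 = 0) /\
   (forall n0 : R, 0 <= n0 -> VS s n0 0 = VL s n0 0) /\
   (forall n0 n1 : R, 0 <= n0 -> 0 < n1 -> VS s n0 n1 > VL s n0 n1)) /\
  (* (v); the second inequality is an equality when n1 = 0, because the two
     functions coincide on that edge *)
  ((forall n0 n1 : R, 0 <= n0 -> 0 <= n1 ->
      partial1 (VS s) n0 n1 > partial1 (VL s) n0 n1) /\
   (forall n0 n1 : R, 0 <= n0 -> 0 < n1 ->
      partial0 (VL s) n0 n1 > partial0 (VS s) n0 n1)).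
Proof.
  assert (HD : forall x y, 0 <= x -> 0 <= y -> denom s x y <> 0).
  { intros x y Hx Hy. now apply Rgt_not_eq, denom_pos. }
  (* All first partials share the denominator [denom ^ 2], so comparing them means comparing
     numerators. *)
  assert (Hdiv : forall a b x y n, 0 <= x -> 0 <= y -> a < b ->
            a / denom s x y ^ n < b / denom s x y ^ n).
  { intros a b x y n Hx Hy Hab. apply Rmult_lt_compat_r; [| assumption].
    now apply Rinv_0_lt_compat, pow_lt, denom_pos. }
  assert (Hpos : forall a x y n, 0 <= x -> 0 <= y -> 0 < a ->
            0 < 2 * a / denom s x y ^ n).
  { intros a x y n Hx Hy Ha.
    apply Rdiv_lt_0_compat; [lra | now apply pow_lt, denom_pos]. }
  assert (HB : forall x, 0 <= x -> 1 + s <= (1 + s) + (1 + 2 * s) * x).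
  { intros x Hx. nra. }
  split; [| split; [| split; [| split]]].
  - split; [now apply VL_strictly_increasing | now apply VS_strictly_increasing].
  - split.
    + split; [now apply VL_strictly_concave | now apply VS_strictly_concave].
    + intros V HV x y Hx Hy.
      pose proof (HB x Hx). pose proof (HB y Hy).
      assert (0 < s ^ 2) by nra.
      destruct HV as [-> | ->].
      * eapply second_partials_neg;
          [ now apply VL_is_derive0, HD | now apply VL_is_derive1, HD
          | now apply VL_is_derive0_partial0, HD
          | now apply VL_is_derive1_partial1, HD
          | now apply VL_is_derive0_partial1, HD | ..];
          apply Hpos; try assumption;
          repeat apply Rmult_lt_0_compat; try apply pow_lt; lra.
      * eapply second_partials_neg;
          [ now apply VS_is_derive0, HD | now apply VS_is_derive1, HD
          | now apply VS_is_derive0_partial0, HD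
          | now apply VS_is_derive1_partial1, HD
          | now apply VS_is_derive0_partial1, HD | ..];
          apply Hpos; try assumption;
          repeat apply Rmult_lt_0_compat; try apply pow_lt; lra.
  - split; [| split].
    + intros x y _ _. unfold VL. f_equal; [| unfold denom]; ring.
    + intros x y Hx Hy Hxy.
      assert (E : denom s y x = denom s x y) by (unfold denom; ring).
      apply Rlt_gt, Rminus_lt_0.
      (* The [VL] parts and the [n0 * n1] terms cancel by symmetry, leaving the terms linear in
         [n1]. *)
      replace (VS s x y - VS s y x)
        with ((y - x) * (1 + 2 * s) / denom s x y)
        by (unfold VS, VL; rewrite E; field; now apply HD).
      apply Rdiv_lt_0_compat; [nra | now apply denom_pos].
    + intros x y Hx Hy. rewrite VS_partial0, VS_partial1 by now apply HD.
      (* The numerators are the squares of a number at least [1 + s] and of [s]. *)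
      pose proof (HB x Hx). apply Hdiv; nra.
  - split; [| split].
    + unfold VS, VL, denom. split; field; lra.
    + intros x Hx. unfold VS. field. apply HD; lra.
    + intros x y Hx Hy. apply Rlt_gt, Rminus_lt_0. unfold VS.
      replace (VL s x y + (3 * s * x * y + 2 * s * y + y + x * y) / denom s x y
               - VL s x y)
        with (y * (3 * s * x + 2 * s + 1 + x) / denom s x y)
        by (field; apply HD; lra).
      apply Rdiv_lt_0_compat; [| apply denom_pos; lra].
      apply Rmult_lt_0_compat; nra.
  - split.
    + intros x y Hx Hy. rewrite VS_partial1, VL_partial1 by now apply HD.
      apply Hdiv; [assumption.. |].
      (* Both numerators are squares, so the bases are compared: the gap
         [(1 + s) + (1 + 2 * s) * x - s * (1 + x)] equals [1 + x + s * x]. *)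
      rewrite <- Rpow_mult_distr. simpl. rewrite !Rmult_1_r.
      apply Rmult_le_0_lt_compat; nra.
    + intros x y Hx Hy. rewrite VS_partial0, VL_partial0 by (apply HD; lra).
      apply Hdiv; [lra.. |].
      (* The claim is now [s ^ 2 < s ^ 2 * (1 + y) ^ 2], strict because [0 < y]. *)
      assert (0 < s ^ 2) by nra. nra.
Qed.
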